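(* Let $P,Q$ be two real polynomials, and let $X$ and $Y$ be independent and identically distributed real random variables with common Stein operator of the form $$A = M - Q(MD) - P(MD)D .$$ Then a Stein operator for $Z = XY$ is $$A_Z = R_1(MD)D^2 + R_2(MD)D + R_3(MD) + M R_4(MD),$$ where, writing $U = MD$, \begin{align*} R_1(U) &= (P(U))^2\,P(U+I)\,(U+I)\,Q(U+2I),\\ R_2(U) &= -(P(U))^2\,Q(U)\,(U+I) - Q(U+I)\,P(U)\,(Q(U))^2,\\ R_3(U) &= -U\,Q(U)\,P(U-I) - Q(U-I)\,(Q(U))^2,\\ R_4(U) &= Q(U-I). \end{align*}
   Context: Operators on functions $f:\mathbb{R}\to\mathbb{R}$: $M(f) = (x\mapsto x f(x))$, $D(f) = (x\mapsto f'(x))$, and $I$ is the identity operator. Products of operators denote composition, and for a real polynomial $P$, $P(MD)$ denotes the polynomial evaluated at the operator $MD$ (so $P(U+I)$, with $U=MD$, is $P$ evaluated at the operator $MD+I$, and so on). Stein operator: an operator $A$ acting on a class of functions $\mathcal{F}$ is a Stein operator for a random variable $X$ if $\mathbb{E}[Af(X)] = 0$ for all $f\in\mathcal{F}$. Standing assumptions: (1) $X$ (and likewise $Y$) admits a smooth density $p$ with respect to Lebesgue measure on $\mathbb{R}$, and this density is defined and non-vanishing on some (possibly unbounded) interval $J\subseteq\mathbb{R}$. (2) $X$ (and likewise $Y$) admits a Stein operator $A$ acting on a class $\mathcal{F}$ which contains the set $\mathcal{C}_0^\infty(\mathbb{R})$ of smooth functions with compact support. *)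

(* Defs.v *)
From mathcomp Require Import all_boot all_order all_algebra.
From mathcomp Require Import all_classical all_reals all_analysis.

Set Implicit Arguments.
Unset Strict Implicit.
Unset Printing Implicit Defensive.

Import Order.TTheory GRing.Theory Num.Theory.
Import numFieldNormedType.Exports.

Local Open Scope classical_set_scope.
Local Open Scope ring_scope.

(* Total maps on all functions R -> R, so that D returns a junk value at points
   of non-differentiability; on smooth functions these are the usual linear
   operators.  Sums and multiples of operators are the canonical pointwise ones
   on function types; products of operators are written [\o]. *)
Definition operator (R : realType) : Type := (R -> R) -> (R -> R).

Section Operators.
Variable R : realType.
Implicit Types (P Q : {poly R}) (T : operator R) (f : R -> R).

Definition opM : operator R := fun f x => x * f x.

Definition opD : operator R := fun f => f^`()%classic.

Definition opI : operator R := idfun.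

Definition opU : operator R := opM \o opD.

(* The polynomial P evaluated at the operator T.  ([horner] does not apply:
   total operators do not form a ring, as f |-> S (T f) is additive in S but
   not in T.) *)
Definition op_poly P T : operator R :=
  fun f => \sum_(i < size P) P`_i *: iter i T f.

Definition stein_factor P Q : operator R :=
  opM - op_poly Q opU - (op_poly P opU \o opD).

Definition R1 P Q : operator R :=
  op_poly P opU \o op_poly P opU \o op_poly P (opU + opI) \o (opU + opI)
    \o op_poly Q (opU + opI *+ 2).

Definition R2 P Q : operator R :=
  - (op_poly P opU \o op_poly P opU \o op_poly Q opU \o (opU + opI))
  - (op_poly Q (opU + opI) \o op_poly P opU \o op_poly Q opU \o op_poly Q opU).

Definition R3 P Q : operator R :=
  - (opU \o op_poly Q opU \o op_poly P (opU - opI))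
  - (op_poly Q (opU - opI) \o op_poly Q opU \o op_poly Q opU).

Definition R4 P Q : operator R := op_poly Q (opU - opI).

Definition stein_product P Q : operator R :=
  (R1 P Q \o opD \o opD) + (R2 P Q \o opD) + R3 P Q + (opM \o R4 P Q).

Definition smooth_on (A : set R) f :=
  forall (n : nat) x, A x -> derivable (f^`(n)%classic) x 1.

Definition Cc_infty : set (R -> R) :=
  [set f | smooth_on setT f /\ compact (closure [set x | f x != 0])].

End Operators.

Section Probability.
Context d (T : measurableType d) (R : realType) (P : probability T R).
Implicit Types X Y : {RV P >-> R}.

(* Integrability is explicit because ['E_P[_]] is total. *)
Definition stein_operator (A : operator R) (F : set (R -> R)) (X : T -> R) :=
  forall f, F f ->
    P.-integrable setT (EFin \o (A f \o X)) /\ ('E_P[A f \o X] = 0)%E.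

(* The density lives on an interval J, positive there; p is unconstrained
   outside J, where the law of X puts no mass.  Smoothness is required at the
   interior points of J only, so that J may contain its endpoints. *)
Definition has_smooth_density X :=
  exists (J : set R) (p : R -> R),
    [/\ is_interval J,
        smooth_on J° p,
        forall x, J x -> 0 < p x &
        forall B, measurable B ->
          distribution P X B = (\int[lebesgue_measure]_(x in B `&` J) (p x)%:E)%E].

Definition independent_RV X Y :=
  forall A B, measurable A -> measurable B ->
    (P (X @^-1` A `&` Y @^-1` B) = P (X @^-1` A) * P (Y @^-1` B))%E.

Definition identically_distributed X Y :=
  forall B, measurable B -> distribution P X B = distribution P Y B.

End Probability.

(* Main.v *)
Require Import Defs.
From HB Require Import structures.
From mathcomp Require Import all_boot all_order all_algebra.
From mathcomp Require Import all_classical all_reals all_analysis.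
From mathcomp Require Import measurable_realfun ring lra.

Set Implicit Arguments.
Unset Strict Implicit.
Unset Printing Implicit Defensive.

Import Order.TTheory GRing.Theory Num.Theory.
Import numFieldNormedType.Exports.

Local Open Scope classical_set_scope.
Local Open Scope ring_scope.

(* Write e f = E[f(XY)], h f = E[Y f(XY)] = E[X f(XY)], U = MD and ' for D.
   Applying the Stein identity of X to x |-> f(xy), to x |-> y f(xy) and to
   x |-> x f(xy), for y fixed, and integrating over y gives
     h f = e (Q(U) f) + h (P(U) f'),
     e (M f) = h (Q(U) f) + E[Y^2 (P(U) f')(XY)],
     E[X^2 g(XY)] = h (Q(U+I) g) + e (P(U) (U+I) g).
   By exchangeability the last two combine into
     e ((M - P(U) (U+I) P(U) D) f) = h ((Q(U) + Q(U+I) P(U) D) f).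
   The functional h is then eliminated by taking the first identity at
   B f = Q(U) Q(U-I) f + Q(U) P(U) Q(U+I) f' and the combined one at
   A f = Q(U-I) f - P(U) Q(U+I) f', because
     (Q(U) + Q(U+I) P(U) D) A = (I - P(U) D) B.
   Integrating over y requires E[X^2] < oo, which is not assumed.  It follows
   from the Stein identity at phi(./t), for an odd bump phi supported in
   1/2 <= |x| <= 4: since U commutes with dilations, b(t) = Pr(t <= |X| <= 2t)
   satisfies b(t) <= (K/t) (b(t/2) + b(t) + b(2t)) for t >= 1, so b decays
   faster than any power of t. *)

(** * Smooth functions and their closure properties *)

Section Smooth.
Variable R : realType.
Implicit Types (f g : R -> R) (a x y : R).

(** The recursion differentiates first and then descends, so that closure under sums and products is
    an induction on [n] with the functions generalized. *)
Fixpoint n_derivable n f : Prop :=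
  if n is m.+1 then (forall x, derivable f x 1) /\ n_derivable m f^`()%classic
  else True.

Lemma smoothP f : smooth_on setT f <-> forall n, n_derivable n f.
Proof.
split=> [sf n|df n x _].
  elim: n f sf => [//|n IHn] f sf; split; first by move=> x; exact: (sf 0%N).
  by apply: IHn => k x _; rewrite -derive1Sn; exact: sf.
elim: n f df => [|n IHn] f df; first by have [+ _] := df 1%N; exact.
by rewrite derive1Sn; apply: IHn => k; have [] := df k.+1.
Qed.

Lemma smooth_derivable f x : smooth_on setT f -> derivable f x 1.
Proof. by move=> sf; exact: (sf 0%N x I). Qed.

Lemma smooth_derive1 f : smooth_on setT f -> smooth_on setT f^`()%classic.
Proof. by move=> sf n x _; rewrite -derive1Sn; exact: sf. Qed.

Lemma smooth_continuous f : smooth_on setT f -> continuous f.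
Proof.
by move=> sf x; apply/differentiable_continuous/derivable1_diffP/smooth_derivable.
Qed.

(** A coinduction principle: exhibiting a parametrized family closed under derivation avoids any
    formula for the derivative of order n. It serves for constants, affine substitutions and the
    functions [flat p]. *)
Lemma smooth_coind (S : set (R -> R)) :
  (forall f, S f -> (forall x, derivable f x 1) /\ S f^`()%classic) ->
  S `<=` smooth_on setT.
Proof.
move=> SD f Sf; apply/smoothP => n; elim: n f Sf => [//|n IHn] f Sf.
by have [df Sf'] := SD f Sf; split=> //; exact: IHn.
Qed.

Lemma n_derivableW n f : n_derivable n.+1 f -> n_derivable n f.
Proof. by elim: n f => [//|n IHn] f [df fn]; split=> //; exact: IHn. Qed.

Lemma derive1D_fun f g :
  (forall x, derivable f x 1) -> (forall x, derivable g x 1) ->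
  (f + g)^`()%classic = f^`()%classic + g^`()%classic.
Proof.
by move=> df dg; apply/funext => x; rewrite derive1E deriveD// fctE !derive1E.
Qed.

Lemma derive1Z_fun a f : (forall x, derivable f x 1) ->
  (a *: f)^`()%classic = a *: f^`()%classic.
Proof.
by move=> df; apply/funext => x; rewrite derive1E deriveZ//= fctE !derive1E.
Qed.

Lemma derive1M_fun f g :
  (forall x, derivable f x 1) -> (forall x, derivable g x 1) ->
  (f * g)^`()%classic = f^`()%classic * g + f * g^`()%classic.
Proof.
move=> df dg; apply/funext => x; rewrite derive1E deriveM// !fctE !derive1E.
by rewrite [LHS]addrC; congr (_ + _); exact: mulrC.
Qed.

Lemma n_derivableD n f g :
  n_derivable n f -> n_derivable n g -> n_derivable n (f + g).
Proof.
elim: n f g => [//|n IHn] f g [df f'] [dg g']; split.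
  by move=> x; exact: derivableD.
by rewrite derive1D_fun//; exact: IHn.
Qed.

Lemma n_derivableM n f g :
  n_derivable n f -> n_derivable n g -> n_derivable n (f * g).
Proof.
elim: n f g => [//|n IHn] f g hf hg; have [df f'] := hf; have [dg g'] := hg.
split; first by move=> x; exact: derivableM.
by rewrite derive1M_fun//; apply: n_derivableD; apply: IHn => //;
  exact: n_derivableW.
Qed.

Lemma smoothD f g :
  smooth_on setT f -> smooth_on setT g -> smooth_on setT (f + g).
Proof.
by move=> /smoothP sf /smoothP sg; apply/smoothP => n; exact: n_derivableD.
Qed.

Lemma smoothM f g :
  smooth_on setT f -> smooth_on setT g -> smooth_on setT (f * g).
Proof.
by move=> /smoothP sf /smoothP sg; apply/smoothP => n; exact: n_derivableM.
Qed.

Lemma smooth_cst a : smooth_on setT (cst a : R -> R).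
Proof.
apply: (@smooth_coind [set f | exists b, f = cst b]); last by exists a.
move=> _ [b ->]; split=> [x|]; first exact: derivable_cst.
by exists 0; apply/funext => x; rewrite derive1_cst.
Qed.

Lemma smooth_id : smooth_on setT (id : R -> R).
Proof.
apply/smoothP => -[//|n]; split=> [x|]; first exact: derivable_id.
have -> : (id : R -> R)^`()%classic = cst 1.
  by apply/funext => x; rewrite derive1E derive_id.
by move: n; apply/smoothP; exact: smooth_cst.
Qed.

Lemma is_derive_affine f a b x : derivable f (a * x + b) 1 ->
  is_derive x 1 (fun x => f (a * x + b)) (a * f^`()%classic (a * x + b)).
Proof.
move=> df; have fd : is_derive (a * x + b) 1 f (f^`()%classic (a * x + b)).
  by rewrite derive1E; apply: DeriveDef.
have gd : is_derive x 1 (fun x : R => a * x + b) a.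
  by apply: is_derive_eq; rewrite /GRing.scale/= mulr1 addr0.
rewrite mulrC.
by apply: (@is_derive1_comp _ f (fun x : R => a * x + b)).
Qed.

Lemma smooth_affine f a b :
  smooth_on setT f -> smooth_on setT (fun x => f (a * x + b)).
Proof.
move=> sf.
(* Each derivation brings out a factor [a], which the scalar [c] absorbs. *)
pose S := [set g | exists c h, smooth_on setT h /\
  g = c *: (fun x : R => h (a * x + b))].
apply: (@smooth_coind S); last by exists 1, f; rewrite scale1r.
move=> _ [c [h [sh ->]]].
have dh x : is_derive x 1 (fun x => h (a * x + b)) (a * h^`()%classic (a * x + b)).
  by apply/is_derive_affine/smooth_derivable.
split=> [x|]; first by apply: derivableZ.
exists (c * a), h^`()%classic; split; first exact: smooth_derive1.
rewrite derive1Z_fun//; apply/funext => x.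
by rewrite !fctE derive1E derive_val /GRing.scale/= mulrA.
Qed.

End Smooth.

(** * The smooth functions p(1/x) exp(-1/x) extended by zero *)

Section Bump.
Variable R : realType.
Implicit Types (f g : R -> R) (p : {poly R}) (x y : R).

(** A polynomial in 1/x is carried along to make the family stable under derivation: [p] becomes X^2
    (p - p'). *)
Definition flat p x : R := if 0 < x then p.[x^-1] * expR (- x^-1) else 0.

(** One term of the exponential series is at most exp t. *)
Lemma exprn_expRN_le n t : 0 < t -> t ^+ n * expR (- t) <= (n`!)%:R :> R.
Proof.
move=> t0; rewrite expRN ler_pdivrMr ?expR_gt0//.
case: n => [|n]; first by rewrite fact0 expr0 mul1r -expR0 ler_expR ltW.
rewrite mulrC -ler_pdivrMr ?ltr0n ?fact_gt0//.
by apply: le_trans (expR_ge1Dxn n (ltW t0)); rewrite ler_wpDl.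
Qed.

Lemma horner_expRN_bounded p :
  exists2 C : R, 0 <= C & forall t : R, 0 < t -> `|p.[t] * expR (- t)| <= C.
Proof.
exists (\sum_(i < size p) `|p`_i| * (i`!)%:R).
  by apply: sumr_ge0 => i _; rewrite mulr_ge0.
move=> t t0; rewrite horner_coef mulr_suml.
apply: le_trans (ler_norm_sum _ _ _) _; apply: ler_sum => i _.
rewrite -mulrA normrM ler_wpM2l// ger0_norm ?exprn_expRN_le//.
by rewrite mulr_ge0 ?expR_ge0// exprn_ge0// ltW.
Qed.

(** Boundedness of t^2 p(t) exp(-t), read at t = 1/x. This is what makes [flat p] differentiable at
    0. *)
Lemma flat_quadratic p : exists C : R, forall x, `|flat p x| <= C * x ^+ 2.
Proof.
have [C C0 pC] := horner_expRN_bounded ('X ^+ 2 * p).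
exists C => x; rewrite /flat; case: ifPn => [x0|_]; last first.
  by rewrite normr0 mulr_ge0 ?sqr_ge0.
have x'0 : 0 < x^-1 by rewrite invr_gt0.
set rhs := C * x ^+ 2; have := pC _ x'0; rewrite !hornerE -mulrA normrM.
rewrite [`|x^-1 ^+ 2|]ger0_norm ?sqr_ge0// exprVn.
by rewrite mulrC ler_pdivrMr ?exprn_gt0.
Qed.

Lemma is_derive0_quadratic f C : (forall x, `|f x| <= C * x ^+ 2) ->
  is_derive (0 : R) 1 f 0.
Proof.
move=> fC; have f0 : f 0 = 0.
  by apply/eqP; rewrite -normr_le0 (le_trans (fC 0))// expr0n mulr0.
have cv : h^-1 *: ((f \o shift (0 : R)) (h *: 1) - f 0) @[h --> 0^'] --> (0 : R).
  apply/cvgrPdist_le => /= e e0; near=> h.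
  have h0 : h != 0 by near: h; exact: nbhs_dnbhs_neq.
  rewrite f0 subr0 /= addr0 sub0r normrN [h *: 1]mulr1 [_ *: f h]mulrC.
  rewrite normrM normfV ler_pdivrMr ?normr_gt0// (le_trans (fC h))//.
  rewrite -real_normK ?num_real// expr2 mulrA ler_wpM2r//.
  (* [C] may vanish, and the bound on |h| is obtained by dividing [e] by a constant; adding 1 keeps
     it positive. *)
  have C1 : 0 < `|C| + 1 by rewrite ltr_wpDl.
  apply: (@le_trans _ _ ((`|C| + 1) * `|h|)).
    by rewrite ler_wpM2r// (le_trans (ler_norm _))// lerDl.
  rewrite -ler_pdivlMl// mulrC; near: h.
  apply: dnbhs0_le; exact: divr_gt0.
apply: DeriveDef; first by apply/cvg_ex; exists 0.
exact: cvg_lim cv.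
Unshelve. all: by end_near. Qed.

(** Left of 0 the function is locally zero, right of 0 the chain rule applies, and at 0 the
    quadratic bound gives derivative 0. *)
Lemma is_derive_flat p x :
  is_derive x 1 (flat p) (flat ('X ^+ 2 * (p - p^`())) x).
Proof.
have [x0|x0|->] := ltgtP x 0.
- rewrite {2}/flat ltNge (ltW x0)/=.
  apply: (@near_eq_is_derive _ _ _ (cst 0)).
    near=> y; rewrite /flat ifN// -leNgt ltW//; near: y.
    exact: lt_nbhsl.
- rewrite {2}/flat x0.
  apply: (@near_eq_is_derive _ _ _ (fun x => p.[x^-1] * expR (- x^-1))).
    near=> y; rewrite /flat ifT//; near: y.
    exact: lt_nbhsr.
  have dp : is_derive x^-1 1 (horner p) p^`().[x^-1].
    by rewrite derivE derive1E; apply: DeriveDef => //; exact: derivable_horner.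
  have dV : is_derive x 1 (fun x : R => x^-1) (- x ^- 2).
    have := @is_deriveV _ id x 1 1; rewrite gt_eqF// => /(_ isT (is_derive_id _ _)).
    by rewrite [_ *: _]mulr1.
  have dpV := is_derive1_comp dp dV.
  have dVN : is_derive x 1 (fun x : R => - x^-1) (x ^- 2).
    by apply: is_derive_eq; rewrite opprK.
  have dE := @is_derive1_comp _ _ (fun x : R => - x^-1) _ _ _
    (is_derive_expR (- x^-1)) dVN.
  apply: (is_derive_eq (is_deriveM dpV dE)).
  rewrite !hornerE /GRing.scale/= exprVn; ring.
- rewrite {2}/flat ltxx.
  by have [C pC] := flat_quadratic p; exact: is_derive0_quadratic pC.
Unshelve. all: by end_near. Qed.

Lemma smooth_flat p : smooth_on setT (flat p).
Proof.
apply: (@smooth_coind _ [set f | exists p, f = flat p]); last by exists p.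
move=> _ [q ->]; have dq x := is_derive_flat q x; split=> //.
by eexists; apply/funext => x; rewrite derive1E derive_val.
Qed.

Lemma flat1_ge0 x : 0 <= flat 1 x.
Proof. by rewrite /flat; case: ifP => // _; rewrite hornerC mul1r expR_ge0. Qed.

Lemma flat1_gt0 x : 0 < x -> 0 < flat 1 x.
Proof. by rewrite /flat => ->; rewrite hornerC mul1r expR_gt0. Qed.

Lemma flat1_le x y : x <= y -> flat 1 x <= flat 1 y.
Proof.
move=> xy; have [x0|x0] := ltP 0 x; last first.
  by rewrite {1}/flat ltNge x0 flat1_ge0.
have y0 := lt_le_trans x0 xy.
by rewrite /flat x0 y0 !hornerC !mul1r ler_expR lerN2 lef_pV2.
Qed.

Lemma flat_le0 p x : x <= 0 -> flat p x = 0.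
Proof. by rewrite /flat ltNge => ->. Qed.

End Bump.

(** * Compactly supported smooth functions and an odd bump *)

Section TestFunctions.
Variable R : realType.
Implicit Types (f g : R -> R) (a b x y : R).

Lemma derive1_eq0_open f (A : set R) : open A ->
  (forall x, A x -> f x = 0) -> forall x, A x -> f^`()%classic x = 0.
Proof.
move=> oA fA x Ax; rewrite derive1E.
rewrite (@near_eq_derive _ _ _ _ (cst 0)) ?derive_cst//.
by near=> y; apply: fA; near: y; exact: open_nbhs_nbhs.
Unshelve. all: by end_near. Qed.

Lemma Cc_inftyP f : Cc_infty f <->
  smooth_on setT f /\ exists a, forall x, a < `|x| -> f x = 0.
Proof.
split=> [[sf cf]|[sf [a fa]]]; split=> //.
  have [M [_ fM]] := compact_bounded cf.
  (* [compact_bounded] bounds the support by every number strictly above [M], hence the shift by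
     1. *)
  exists (M + 1) => x Mx; apply/eqP; apply: contraTT Mx => fx0.
  rewrite -leNgt; apply: (fM (M + 1)); first by rewrite ltrDl.
  exact: subset_closure.
apply: (@subclosed_compact _ _ `[- a, a]).
- exact: closed_closure.
- exact: segment_compact.
- rewrite [X in _ `<=` X](_ : _ = closure `[- a, a]).
    apply: closureS => x /= fx0; rewrite in_itv/= -ler_norml leNgt.
    by apply/negP => /fa fx; rewrite fx eqxx in fx0.
  by apply/closure_id; exact: interval_closed.
Qed.

Lemma Cc_smooth f : Cc_infty f -> smooth_on setT f.
Proof. by case. Qed.

Lemma Cc_derivable f x : Cc_infty f -> derivable f x 1.
Proof. by move=> /Cc_smooth; exact: smooth_derivable. Qed.

Lemma CcD f g : Cc_infty f -> Cc_infty g -> Cc_infty (f + g).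
Proof.
move=> /Cc_inftyP[sf [a fa]] /Cc_inftyP[sg [b gb]]; apply/Cc_inftyP; split.
  exact: smoothD.
by exists (Num.max a b) => x; rewrite gt_max => /andP[ax bx];
  rewrite fctE fa// gb// addr0.
Qed.

Lemma CcM f g : Cc_infty f -> smooth_on setT g -> Cc_infty (g * f).
Proof.
move=> /Cc_inftyP[sf [a fa]] sg; apply/Cc_inftyP; split; first exact: smoothM.
by exists a => x ax; rewrite fctE fa// mulr0.
Qed.

Lemma CcZ a f : Cc_infty f -> Cc_infty (a *: f).
Proof. by move=> cf; exact: (CcM cf (@smooth_cst R a)). Qed.

Lemma CcN f : Cc_infty f -> Cc_infty (- f).
Proof. by rewrite -scaleN1r; exact: CcZ. Qed.

Lemma CcB f g : Cc_infty f -> Cc_infty g -> Cc_infty (f - g).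
Proof. by move=> cf cg; apply: CcD => //; exact: CcN. Qed.

Lemma Cc0 : Cc_infty (0 : R -> R).
Proof. by apply/Cc_inftyP; split; [exact: smooth_cst|exists 0]. Qed.

Lemma Cc_sum I (r : seq I) (F : I -> R -> R) :
  (forall i, Cc_infty (F i)) -> Cc_infty (\sum_(i <- r) F i).
Proof.
by move=> cF; elim/big_rec: _ => [|i f _ cf]; [exact: Cc0|exact: CcD].
Qed.

Lemma Cc_opM f : Cc_infty f -> Cc_infty (opM f).
Proof. by move=> cf; exact: CcM cf (@smooth_id R). Qed.

Lemma Cc_opD f : Cc_infty f -> Cc_infty (opD f).
Proof.
move=> /Cc_inftyP[sf [a fa]]; apply/Cc_inftyP; split; first exact: smooth_derive1.
exists a; apply: derive1_eq0_open fa.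
apply: (@open_comp _ _ (Num.norm : R -> R) [set y | a < y]); last exact: open_gt.
by move=> x _; exact: norm_continuous.
Qed.

Lemma Cc_opU f : Cc_infty f -> Cc_infty (opU f).
Proof. by move=> cf; exact/Cc_opM/Cc_opD. Qed.

Lemma Cc_affine a b f : a != 0 -> Cc_infty f ->
  Cc_infty (fun x => f (a * x + b)).
Proof.
move=> a0 /Cc_inftyP[sf [c fc]]; apply/Cc_inftyP; split.
  exact: smooth_affine.
exists ((`|c| + `|b|) / `|a|) => x; rewrite ltr_pdivrMr ?normr_gt0// => cx.
apply: fc; apply: (le_lt_trans (ler_norm c)).
have := ler_normB (a * x + b) b; rewrite addrK normrM; lra.
Qed.

Lemma Cc_scale a f : a != 0 -> Cc_infty f -> Cc_infty (fun x => f (a * x)).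
Proof.
by move=> a0 /(Cc_affine 0 a0); under eq_fun do rewrite addr0.
Qed.

Lemma Cc_bounded f : Cc_infty f -> exists2 C, 0 <= C & forall x, `|f x| <= C.
Proof.
move=> /Cc_inftyP[sf [a fa]].
have a0 : - `|a| <= `|a| by rewrite (@le_trans _ _ 0)// oppr_le0.
have cf : {within `[- `|a|, `|a|], continuous (fun x => `|f x|)}.
  apply: continuous_subspaceT => x.
  apply: (@continuous_comp _ _ _ f Num.norm); last exact: norm_continuous.
  exact: smooth_continuous.
have [c _ fc] := EVT_max a0 cf.
exists `|f c| => // x; have [xa|xa] := leP `|x| `|a|.
  by apply: fc; rewrite in_itv/= -ler_norml.
by rewrite fa ?normr0// (le_lt_trans (ler_norm a)).
Qed.

(** Take h(x) - h(-x) with h(x) = flat(x - 1/2) flat(4 - x). Oddness makes x f(x) nonnegative on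
    both half-lines, so that no cancellation occurs in E[X f(X/t)]. *)
Lemma bump_exists : exists f : R -> R,
  [/\ Cc_infty f, forall x, `|x| < 1/2 \/ 4 < `|x| -> f x = 0 &
   exists2 c, 0 < c & forall x, 0 <= x * f x /\ (1 <= `|x| <= 2 -> c <= x * f x)].
Proof.
pose h x := flat 1 (1 * x + (- 2^-1)) * flat 1 ((-1) * x + 4).
have sh : smooth_on setT h.
  by apply: smoothM; apply/smooth_affine/smooth_flat.
have h0 x : x <= 2^-1 \/ 4 <= x -> h x = 0.
  rewrite /h; case=> ?; first by rewrite flat_le0 ?mul0r//; lra.
  by rewrite [X in _ * X]flat_le0 ?mulr0//; lra.
have h_ge0 x : 0 <= h x by rewrite mulr_ge0 ?flat1_ge0.
have ch : Cc_infty h.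
  apply/Cc_inftyP; split => //; exists 4 => x x4; apply: h0.
  by have [x0|x0] := leP 0 x; [right; rewrite ltW// -(ger0_norm x0)|left; lra].
have chN : Cc_infty (fun x => h (- x)).
  have := Cc_scale (_ : -1 != 0 :> R) ch.
  by under eq_fun do rewrite mulN1r; apply; rewrite oppr_eq0 oner_eq0.
exists (h - (fun x => h (- x))); split.
- exact: CcB.
- move=> x hx; rewrite !fctE !h0 ?subrr//.
    by case: hx; have [x0|x0] := leP 0 x; rewrite ?(ger0_norm x0) ?(ltr0_norm x0); lra.
  by case: hx; have [x0|x0] := leP 0 x; rewrite ?(ger0_norm x0) ?(ltr0_norm x0); lra.
(* On [1, 2] both x - 1/2 and 4 - x are at least 1/2, so each factor of [h] is at least [c], and x
   >= 1. *)
pose c : R := flat 1 2^-1.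
have c0 : 0 < c by apply: flat1_gt0; rewrite invr_gt0.
have hc x : 1 <= x <= 2 -> c ^+ 2 <= x * h x.
  move=> /andP[x1 x2].
  have : c * c <= h x.
    by apply: ler_pM; rewrite ?(ltW c0)//; apply: flat1_le; lra.
  rewrite -expr2 => /le_trans; apply; rewrite ler_peMl//.
exists (c ^+ 2) => [|x]; first by rewrite exprn_gt0.
have [x0|x0] := leP 0 x.
  rewrite !fctE (h0 (- x)) ?subr0; last by left; lra.
  split; first by rewrite mulr_ge0.
  by rewrite ger0_norm//; exact: hc.
rewrite !fctE (h0 x) ?sub0r ?mulrN -?mulNr; last by left; lra.
split; first by rewrite mulr_ge0// oppr_ge0 ltW.
by rewrite ltr0_norm//; exact: hc.
Qed.

End TestFunctions.

(** * Polynomials evaluated at an operator on test functions *)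

Section OperatorCalculus.
Variable R : realType.
Implicit Types (f g : R -> R) (a b x y : R) (p q r : {poly R}).
Implicit Types (S T : operator R).

(** Linearity is asked on test functions only, since [opD] is not additive at points of
    non-differentiability. *)
Definition Cc_linear S :=
  (forall f g, Cc_infty f -> Cc_infty g -> S (f + g) = S f + S g) /\
  (forall a f, Cc_infty f -> S (a *: f) = a *: S f).

Definition Cc_stable T := forall f, Cc_infty f -> Cc_infty (T f).

Lemma Cc_linear_comp S T :
  Cc_linear S -> Cc_linear T -> Cc_stable T -> Cc_linear (S \o T).
Proof.
move=> [SD SZ] [TD TZ] cT; split=> [f g cf cg|a f cf] /=.
  by rewrite TD// SD//; exact: cT.
by rewrite TZ// SZ//; exact: cT.
Qed.

Lemma opMD f g : opM (f + g) = opM f + opM g.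
Proof. by apply/funext => x; rewrite /opM !fctE mulrDr. Qed.

Lemma opMZ a f : opM (a *: f) = a *: opM f.
Proof. by apply/funext => x; rewrite /opM !fctE /GRing.scale/= mulrCA. Qed.

Lemma Cc_linear_opM : Cc_linear (@opM R).
Proof. by split=> [f g _ _|a f _]; [exact: opMD|exact: opMZ]. Qed.

Lemma Cc_linear_opD : Cc_linear (@opD R).
Proof.
split=> [f g cf cg|a f cf].
  by apply: derive1D_fun => x; exact: Cc_derivable.
by apply: derive1Z_fun => x; exact: Cc_derivable.
Qed.

Lemma Cc_linear_opU : Cc_linear (@opU R).
Proof. exact: (Cc_linear_comp Cc_linear_opM Cc_linear_opD (@Cc_opD R)). Qed.

Lemma Cc_linear_sum S (I : Type) (s : seq I) (c : I -> R) (F : I -> R -> R) :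
  Cc_linear S -> (forall i, Cc_infty (F i)) ->
  S (\sum_(i <- s) c i *: F i) = \sum_(i <- s) c i *: S (F i).
Proof.
move=> [SD SZ] cF; elim: s => [|i s IHs].
  by rewrite !big_nil -(scale0r (0 : R -> R)) SZ ?scale0r//; exact: Cc0.
rewrite !big_cons SD ?SZ ?IHs//; first exact: CcZ.
by apply: Cc_sum => j; exact: CcZ.
Qed.

Lemma Cc_iter T f n : Cc_stable T -> Cc_infty f -> Cc_infty (iter n T f).
Proof. by move=> cT cf; elim: n => //= n; exact: cT. Qed.

Lemma Cc_op_poly p T : Cc_stable T -> Cc_stable (op_poly p T).
Proof. by move=> cT f cf; apply: Cc_sum => i; apply: CcZ; exact: Cc_iter. Qed.

(** The relation S T = T' S passes to powers, then to linear combinations. It is the single source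
    of the commutation rules of P(U) with D, M, dilations and other polynomials in U. *)
Lemma op_poly_intertwine S T T' p f : Cc_linear S -> Cc_stable T ->
  (forall g, Cc_infty g -> S (T g) = T' (S g)) -> Cc_infty f ->
  S (op_poly p T f) = op_poly p T' (S f).
Proof.
move=> lS cT ST cf; rewrite /op_poly Cc_linear_sum//; last first.
  by move=> i; exact: Cc_iter.
apply: eq_bigr => i _; congr (_ *: _).
elim: (i : nat) => //= n IHn; rewrite ST ?IHn//; exact: Cc_iter.
Qed.

Lemma op_poly_widen n p T f : (size p <= n)%N ->
  op_poly p T f = \sum_(i < n) p`_i *: iter i T f.
Proof.
move=> pn; rewrite /op_poly (big_ord_widen n (fun i => p`_i *: iter i T f))//.
rewrite big_mkcond; apply: eq_bigr => i _; case: ltnP => // pi.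
by rewrite nth_default// scale0r.
Qed.

Lemma op_polyD p q T f : op_poly (p + q) T f = op_poly p T f + op_poly q T f.
Proof.
pose n := maxn (size p) (size q).
rewrite !(@op_poly_widen n) ?leq_maxl ?leq_maxr//; last exact: size_polyD.
by rewrite -big_split; apply: eq_bigr => i _; rewrite coefD scalerDl.
Qed.

Lemma op_polyZ a p T f : op_poly (a *: p) T f = a *: op_poly p T f.
Proof.
rewrite (@op_poly_widen (size p)) ?size_scale_leq// /op_poly scaler_sumr.
by apply: eq_bigr => i _; rewrite coefZ scalerA.
Qed.

Lemma op_poly_sum n (c : 'I_n -> {poly R}) T f :
  op_poly (\sum_(i < n) c i) T f = \sum_(i < n) op_poly (c i) T f.
Proof.
apply: (big_morph (fun p => op_poly p T f)) => [p q|]; first exact: op_polyD.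
by rewrite /op_poly size_poly0 big_ord0.
Qed.

Lemma op_polyC a T f : op_poly a%:P T f = a *: f.
Proof.
rewrite (@op_poly_widen 1) ?size_polyC_leq1//.
by rewrite big_ord_recl big_ord0 addr0 coefC.
Qed.

Lemma op_polyMX p T f : op_poly (p * 'X) T f = op_poly p T (T f).
Proof.
rewrite (@op_poly_widen (size p).+1); last first.
  by rewrite (leq_trans (size_polyMleq _ _))// size_polyX addn2.
rewrite big_ord_recl coefMX scale0r add0r; apply: eq_bigr => i _.
by rewrite coefMX/= -iterSr.
Qed.

Lemma Cc_linear_op_poly p T : Cc_linear T -> Cc_stable T ->
  Cc_linear (op_poly p T).
Proof.
move=> lT cT; have lI n : Cc_linear (iter n T).
  elim: n => // n IHn; exact: (Cc_linear_comp lT IHn (fun f => @Cc_iter _ f n cT)).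
split=> [f g cf cg|a f cf].
  rewrite /op_poly -big_split; apply: eq_bigr => i _ /=.
  by have [-> // _] := lI i; rewrite scalerDr.
rewrite /op_poly scaler_sumr; apply: eq_bigr => i _ /=.
by have [_ -> //] := lI i; rewrite !scalerA mulrC.
Qed.

(** Induction on [p] in Horner form p X + c; moving X past [q] uses that q(T) commutes with T. *)
Lemma op_polyM p q T f : Cc_linear T -> Cc_stable T -> Cc_infty f ->
  op_poly (p * q) T f = op_poly p T (op_poly q T f).
Proof.
move=> lT cT; elim/poly_ind: p f => [|p c IHp] f cf.
  by rewrite mul0r /op_poly size_poly0 !big_ord0.
rewrite mulrDl !op_polyD op_polyC mul_polyC op_polyZ op_polyMX.
rewrite -mulrA (mulrC 'X) mulrA op_polyMX IHp; last exact: cT.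
by rewrite (op_poly_intertwine q lT cT (fun _ _ => erefl)).
Qed.

Lemma op_poly_comp p q T T' f : Cc_linear T -> Cc_stable T ->
  (forall g, Cc_infty g -> T' g = op_poly q T g) -> Cc_infty f ->
  op_poly p T' f = op_poly (p \Po q) T f.
Proof.
move=> lT cT T'q cf; rewrite comp_polyE op_poly_sum.
apply: eq_bigr => i _; rewrite op_polyZ; congr (_ *: _).
elim: (i : nat) => [|n IHn]; first by rewrite expr0 op_polyC scale1r.
rewrite iterS IHn exprS op_polyM// T'q//; exact: Cc_op_poly.
Qed.

End OperatorCalculus.

(** * Commutation of P(U) with D, M and dilations *)

Section PolynomialsInU.
Variable R : realType.
Implicit Types (f g : R -> R) (a b x y : R) (p q r : {poly R}).

Definition evU p : operator R := op_poly p (@opU R).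

Lemma Cc_evU p f : Cc_infty f -> Cc_infty (evU p f).
Proof. by apply: Cc_op_poly; exact: Cc_opU. Qed.

Lemma Cc_linear_evU p : Cc_linear (evU p).
Proof. by apply: Cc_linear_op_poly; [exact: Cc_linear_opU|exact: Cc_opU]. Qed.

Lemma evUM p q f : Cc_infty f -> evU (p * q) f = evU p (evU q f).
Proof. by apply: op_polyM; [exact: Cc_linear_opU|exact: Cc_opU]. Qed.

Lemma evU_shift a f : evU ('X + a%:P) f = opU f + a *: f.
Proof.
by rewrite /evU op_polyD op_polyC -['X]mul1r op_polyMX op_polyC scale1r.
Qed.

(** Turns P(U + aI) into a polynomial in U itself, so that operator identities reduce to identities
    in the commutative ring of polynomials. *)
Definition shiftp a p := p \Po ('X + a%:P).

Lemma op_poly_shift a p T f :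
  (forall g, Cc_infty g -> T g = opU g + a *: g) -> Cc_infty f ->
  op_poly p T f = evU (shiftp a p) f.
Proof.
move=> Ta cf; apply: op_poly_comp => //.
- exact: Cc_linear_opU.
- exact: Cc_opU.
- by move=> g cg; rewrite Ta// -evU_shift.
Qed.

Lemma opD_opM f : Cc_infty f -> opD (opM f) = opU f + f.
Proof.
move=> cf; rewrite /opD (_ : opM f = id * f)// derive1M_fun//; last first.
  by move=> x; exact: Cc_derivable.
apply/funext => x; rewrite !fctE derive1E derive_id mul1r; exact: addrC.
Qed.

Lemma opD_opU f : Cc_infty f -> opD (opU f) = opU (opD f) + opD f.
Proof. by move=> cf; exact/opD_opM/Cc_opD. Qed.

(** Comes from D U = (U + I) D. *)
Lemma opD_evU p f : Cc_infty f -> opD (evU p f) = evU (shiftp 1 p) (opD f).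
Proof.
move=> cf; rewrite -(@op_poly_shift 1 _ (@opU R + @opI R)).
- apply: op_poly_intertwine => //.
  + exact: Cc_linear_opD.
  + exact: Cc_opU.
  + by move=> g cg; rewrite opD_opU.
- by move=> g _; rewrite scale1r.
- exact: Cc_opD.
Qed.

Lemma opU_opM f : Cc_infty f -> opU (opM f) = opM (opU f) + opM f.
Proof.
by move=> cf; rewrite [LHS]/opU/= opD_opM// opMD.
Qed.

(** Comes from M U = (U - I) M. *)
Lemma opM_evU p f : Cc_infty f -> opM (evU p f) = evU (shiftp (-1) p) (opM f).
Proof.
move=> cf; rewrite -(@op_poly_shift (-1) _ (@opU R - @opI R)).
- apply: op_poly_intertwine => //.
  + exact: Cc_linear_opM.
  + exact: Cc_opU.
  + move=> g cg; rewrite [RHS](_ : _ = opU (opM g) - opM g)//.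
    by rewrite opU_opM// addrK.
- by move=> g _; rewrite scaleN1r.
- exact: Cc_opM.
Qed.

Lemma opU_scale f a : Cc_infty f ->
  opU (fun x => f (a * x)) = (fun x => opU f (a * x)).
Proof.
move=> cf; have df x := @is_derive_affine R f a 0 x (@Cc_derivable _ _ _ cf).
apply/funext => x; rewrite /opU /= /opM /opD derive1E.
have {}df := df x; rewrite addr0 in df; under eq_fun do rewrite -[a * _]addr0.
by rewrite derive_val mulrCA mulrA.
Qed.

Lemma opD_scale f a : Cc_infty f ->
  opD (fun x => f (a * x)) = a *: (fun x => opD f (a * x)).
Proof.
move=> cf; have df x := @is_derive_affine R f a 0 x (@Cc_derivable _ _ _ cf).
apply/funext => x; rewrite /opD derive1E.
have {}df := df x; rewrite addr0 in df; under eq_fun do rewrite -[a * _]addr0.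
by rewrite derive_val.
Qed.

Lemma evU_scale p f a : Cc_infty f ->
  evU p (fun x => f (a * x)) = (fun x => evU p f (a * x)).
Proof.
move=> cf; apply: esym.
apply: (@op_poly_intertwine _ (fun g x => g (a * x)) (@opU R)) => //.
- exact: Cc_opU.
- by move=> g cg; rewrite opU_scale.
Qed.

(** The map sending g to x g(ax) intertwines U + I with U, because U commutes with dilations and U M
    = M (U + I). *)
Lemma evU_opM_scale p f a : a != 0 -> Cc_infty f ->
  evU p (opM (fun x => f (a * x))) =
  opM (fun x => evU (shiftp 1 p) f (a * x)).
Proof.
move=> a0 cf; rewrite -(@op_poly_shift 1 _ (@opU R + @opI R))//; last first.
  by move=> g _; rewrite scale1r.
apply: esym; apply: (@op_poly_intertwine _ (fun g => opM (fun x => g (a * x)))) => //.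
- by split=> [g h _ _|b g _]; rewrite -(opMD, opMZ).
- by move=> g cg; apply: CcD => //; exact: Cc_opU.
- move=> g cg; rewrite opU_opM; last exact: Cc_scale.
  by rewrite opU_scale// -opMD.
Qed.

End PolynomialsInU.

Ltac solve_Cc := repeat lazymatch goal with
  | |- Cc_infty (evU _ _) => apply: Cc_evU
  | |- Cc_infty (opD _) => apply: Cc_opD
  | |- Cc_infty (opM _) => apply: Cc_opM
  | |- Cc_infty (opU _) => apply: Cc_opU
  | |- Cc_infty (_ - _) => apply: CcB
  | |- Cc_infty (_ + _) => apply: CcD
  | |- Cc_infty _ => assumption
  end.

(** * Algebraic elimination leading to the product operator *)

Section ProductAlgebra.
Variable R : realType.
Implicit Types (f g : R -> R) (p q r : {poly R}).

Lemma shiftpM a p q : shiftp a (p * q) = shiftp a p * shiftp a q :> {poly R}.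
Proof. exact: comp_polyM. Qed.

Lemma shiftp_comp a b p : shiftp a (shiftp b p) = shiftp (a + b) p :> {poly R}.
Proof.
rewrite /shiftp -comp_polyA comp_polyD comp_polyX comp_polyC.
by rewrite -addrA -polyCD.
Qed.

Lemma shiftp0 p : shiftp 0 p = p :> {poly R}.
Proof. by rewrite /shiftp polyC0 addr0 comp_polyXr. Qed.

Lemma evUD p q f : evU (p + q) f = evU p f + evU q f.
Proof. exact: op_polyD. Qed.

Lemma evUN p f : evU (- p) f = - evU p f.
Proof. by rewrite -scaleN1r /evU op_polyZ scaleN1r. Qed.

Lemma evU_sub p f g : Cc_infty f -> Cc_infty g ->
  evU p (f - g) = evU p f - evU p g.
Proof.
move=> cf cg; have [pD pZ] := Cc_linear_evU p.
have -> : - g = -1 *: g by rewrite scaleN1r.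
rewrite pD//; last exact: CcZ.
by rewrite (pZ (-1) g cg) scaleN1r.
Qed.

Lemma evU_add p f g : Cc_infty f -> Cc_infty g ->
  evU p (f + g) = evU p f + evU p g.
Proof. by have [+ _] := Cc_linear_evU p; apply. Qed.

Lemma evUX f : evU 'X f = opU f.
Proof. by have := evU_shift 0 f; rewrite scale0r !addr0. Qed.

(** A normal form with one polynomial in U in front of each of f'', f' and f, on which [ring] can
    decide equality of coefficients. *)
Lemma stein_productE (P Q : {poly R}) f : Cc_infty f ->
  let P1 := shiftp 1 P in let P1' := shiftp (-1) P in
  let Q1 := shiftp 1 Q in let Q2 := shiftp 2 Q in let Q1' := shiftp (-1) Q in
  stein_product P Q f =
    evU (P * P * P1 * ('X + 1) * Q2) (opD (opD f))
    - evU (P * P * Q * ('X + 1) + Q1 * P * Q * Q) (opD f)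
    - evU ('X * Q * P1' + Q1' * Q * Q) f + opM (evU Q1' f).
Proof.
move=> cf P1 P1' Q1 Q2 Q1'.
have U1 g : (@opU R + @opI R) g = evU ('X + 1) g.
  by rewrite evU_shift scale1r.
have p1 p g : Cc_infty g -> op_poly p (@opU R + @opI R) g = evU (shiftp 1 p) g.
  by apply: op_poly_shift => ? _; rewrite scale1r.
have p2 p g : Cc_infty g ->
    op_poly p (@opU R + @opI R *+ 2) g = evU (shiftp 2 p) g.
  by apply: op_poly_shift => h _; rewrite scaler_nat.
have p1' p g : Cc_infty g ->
    op_poly p (@opU R - @opI R) g = evU (shiftp (-1) p) g.
  by apply: op_poly_shift => h _; rewrite scaleN1r.
have cf' := Cc_opD cf; have cf'' := Cc_opD cf'.
have -> : stein_product P Q f =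
    R1 P Q (opD (opD f)) + R2 P Q (opD f) + R3 P Q f + opM (R4 P Q f) by [].
congr (_ + _ + _ + _).
- rewrite [LHS](_ : _ = evU P (evU P (op_poly P (@opU R + @opI R)
    ((@opU R + @opI R) (op_poly Q (@opU R + @opI R *+ 2) (opD (opD f)))))))//.
  by rewrite p2// U1 p1 -?evUM; solve_Cc; rewrite ?mulrA.
- rewrite [LHS](_ : _ =
    - evU P (evU P (evU Q ((@opU R + @opI R) (opD f))))
    - op_poly Q (@opU R + @opI R) (evU P (evU Q (evU Q (opD f)))))//.
  rewrite U1 p1 -?evUM//; try solve_Cc.
  by rewrite evUD opprD ?mulrA.
- rewrite [LHS](_ : _ =
    - opU (evU Q (op_poly P (@opU R - @opI R) f))
    - op_poly Q (@opU R - @opI R) (evU Q (evU Q f)))//.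
  rewrite !p1' -?evUX -?evUM//; try solve_Cc.
  by rewrite evUD opprD ?mulrA.
- by rewrite /R4 p1'.
Qed.

(** The elimination is purely algebraic: [e] and [h] stand for any additive functionals satisfying
    the two identities. The product operator at f equals M A - P(U) (U + I) P(U) D A - Q(U) B. *)
Lemma stein_product_eq0 (P Q : {poly R}) (e h : (R -> R) -> R) f :
  (forall f g, Cc_infty f -> Cc_infty g -> e (f + g) = e f + e g) ->
  (forall f g, Cc_infty f -> Cc_infty g -> h (f + g) = h f + h g) ->
  (forall g, Cc_infty g -> h g = e (evU Q g) + h (evU P (opD g))) ->
  (forall g, Cc_infty g ->
    e (opM g) = h (evU Q g) + h (evU (shiftp 1 Q) (evU P (opD g)))
                + e (evU P (evU ('X + 1) (evU P (opD g))))) ->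
  Cc_infty f -> e (stein_product P Q f) = 0.
Proof.
move=> eD hD stein1 stein2 cf.
have lin0 (l : (R -> R) -> R) :
    (forall f g, Cc_infty f -> Cc_infty g -> l (f + g) = l f + l g) -> l 0 = 0.
  move=> lD; apply: (@addrI _ (l 0)).
  by rewrite -lD ?addr0//; exact: Cc0.
have linB (l : (R -> R) -> R) :
    (forall f g, Cc_infty f -> Cc_infty g -> l (f + g) = l f + l g) ->
    forall f g, Cc_infty f -> Cc_infty g -> l (f - g) = l f - l g.
  move=> lD f1 f2 c1 c2; apply: (@addIr _ (l f2)); rewrite -lD//; last exact: CcB.
  by rewrite !subrK.
have eB := linB _ eD; have hB := linB _ hD.
have cf' := Cc_opD cf; have cf'' := Cc_opD cf'.
pose P1 := shiftp 1 P; pose P1' := shiftp (-1) P.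
pose Q1 := shiftp 1 Q; pose Q2 := shiftp 2 Q; pose Q1' := shiftp (-1) Q.
have sQ1' : shiftp 1 Q1' = Q by rewrite shiftp_comp subrr shiftp0.
have sQ1 : shiftp 1 Q1 = Q2 by rewrite shiftp_comp.
have s'Q1 : shiftp (-1) Q1 = Q by rewrite shiftp_comp addNr shiftp0.
pose A := evU Q1' f - evU (P * Q1) (opD f).
pose B := evU (Q * Q1') f + evU (Q * P * Q1) (opD f).
have cE p g : Cc_infty g -> Cc_infty (evU p g) by exact: Cc_evU.
have cA : Cc_infty A by apply: CcB; exact: cE.
have cB : Cc_infty B by apply: CcD; exact: cE.
have [DD _] := @Cc_linear_opD R.
have DA : opD A = evU Q (opD f) - evU (P1 * Q2) (opD (opD f)).
  rewrite /A -evUN DD ?opD_evU//; try solve_Cc.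
  have -> : shiftp 1 (- (P * Q1)) = - (P1 * Q2).
    by rewrite /shiftp raddfN; congr (- _); rewrite [LHS]shiftpM sQ1.
  by rewrite sQ1' evUN.
have DB : opD B = evU (Q1 * Q) (opD f) + evU (Q1 * P1 * Q2) (opD (opD f)).
  rewrite /B DD ?opD_evU//; try solve_Cc.
  by rewrite !shiftpM sQ1' sQ1.
have MA : opM A = opM (evU Q1' f) - evU (P1' * Q * 'X) f.
  rewrite /A opMD -scaleN1r opMZ scaleN1r; congr (_ - _).
  by rewrite opM_evU// shiftpM s'Q1 [RHS]evUM// evUX.
have := stein1 _ cB; have := stein2 _ cA.
rewrite stein_productE// -/P1 -/P1' -/Q1 -/Q2 -/Q1'.
rewrite DA DB MA /A /B.
rewrite !(evU_sub, evU_add); try solve_Cc.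
rewrite -!evUM; try solve_Cc.
rewrite !(eB, eD, hB, hD); try solve_Cc.
rewrite !evUD !eD; try solve_Cc.
(* Products equal up to order are given one common form, so that equal terms become the same atom.
   Six values of [e] and three of [h] remain; the latter cancel between the two identities. *)
have perm p q g : p = q -> evU p g = evU q g by move=> ->.
rewrite (perm (P1' * Q * 'X) ('X * Q * P1') f); last by ring.
rewrite (perm (Q * (P * Q1)) (Q * P * Q1)); last by ring.
rewrite (perm (Q1 * P * Q) (Q * P * Q1)); last by ring.
rewrite (perm (P * (Q1 * Q)) (Q * P * Q1)); last by ring.
rewrite (perm (Q1 * P * (P1 * Q2)) (P * (Q1 * P1 * Q2))); last by ring.
rewrite (perm (P * ('X + 1) * P * Q) (P * P * Q * ('X + 1))); last by ring.
rewrite (perm (P * ('X + 1) * P * (P1 * Q2)) (P * P * P1 * ('X + 1) * Q2)); last by ring.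
rewrite (perm (Q1 * P * Q * Q) (Q * (Q * P * Q1))); last by ring.
rewrite (perm (Q1' * Q * Q) (Q * (Q * Q1'))); last by ring.
move: (e _) (e _) (e _) (e _) (e _) (e _) (h _) (h _) (h _) => *; lra.
Qed.

End ProductAlgebra.

(** * The Stein operator on dilated test functions *)

Section SteinFactor.
Variable R : realType.
Implicit Types (f g : R -> R) (a x y : R) (P Q : {poly R}).

Lemma stein_factor_scale P Q f a x : Cc_infty f ->
  stein_factor P Q (fun x => f (a * x)) x =
  x * f (a * x) - evU Q f (a * x) - a * evU P (opD f) (a * x).
Proof.
move=> cf; have -> : stein_factor P Q (fun x => f (a * x)) x =
  x * f (a * x) - evU Q (fun x => f (a * x)) x
  - evU P (opD (fun x => f (a * x))) x by [].
rewrite opD_scale// evU_scale//; congr (_ - _).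
(* For a = 0 the dilated derivative is constant and need not have compact support, so homogeneity is
   applied to the zero function instead. *)
have [->|a0] := eqVneq a 0.
  rewrite scale0r mul0r; have [_ +] := Cc_linear_evU P.
  by move=> /(_ 0 0 (@Cc0 R)); rewrite !scale0r => ->.
have [_ ->] := Cc_linear_evU P.
  by rewrite evU_scale//; exact: Cc_opD.
exact/Cc_scale/Cc_opD.
Qed.

Lemma Cc_measurable f : Cc_infty f -> measurable_fun setT f.
Proof.
by move=> cf; apply: continuous_measurable_fun; exact/smooth_continuous/Cc_smooth.
Qed.

End SteinFactor.

(** * Tail decay on dyadic shells and finiteness of E[X^2] *)

Section SecondMoment.
Context d (T : measurableType d) (R : realType) (Pr : probability T R).
Variables (X : {RV Pr >-> R}) (P Q : {poly R}).
Hypothesis steinX : stein_operator Pr (stein_factor P Q) (@Cc_infty R) X.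

Let shell (t : R) : set T := [set w | t <= `|X w| <= 2 * t].

Let b (t : R) : R := fine (Pr (shell t)).

Let mX : measurable_fun setT (fun w => `|X w|).
Proof. exact: measurableT_comp. Qed.

Let measurable_shell t : measurable (shell t).
Proof.
rewrite [shell t](_ : _ = (fun w => `|X w|) @^-1` `[t, 2 * t]).
  by rewrite -[X in measurable X]setTI; exact: mX.
by apply/seteqP; split=> w /=; rewrite in_itv.
Qed.

Let b_ge0 t : 0 <= b t. Proof. exact: fine_ge0. Qed.

Let b_le1 t : b t <= 1.
Proof.
by rewrite -lee_fin fineK ?fin_num_measure// probability_le1.
Qed.

Let indic_shell t w : \1_(shell t) w = (t <= `|X w| <= 2 * t)%R%:R :> R.
Proof. by rewrite indicE; congr (nat_of_bool _)%:R; rewrite mem_setE. Qed.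

Let shell_integrable t : Pr.-integrable setT (EFin \o \1_(shell t)).
Proof. exact: integrable_indic. Qed.

Let Rintegral_shell t : (\int[Pr]_w \1_(shell t) w)%R = b t.
Proof. by rewrite /Rintegral integral_indic// setIT. Qed.

(** With x = ty, the Stein operator at phi(x/t) is t y phi(y) - (Q(U) phi)(y) - (P(U) phi')(y)/t.
    The first term is at least tc on the shell of [t]; the others are bounded and live on three
    neighbouring shells. Taking expectations gives the claim. *)
Lemma shell_recurrence : exists2 K : R, 0 <= K &
  forall t : R, 1 <= t -> b t <= K / t * (b (2^-1 * t) + b t + b (2 * t)).
Proof.
have [phi [cphi phi0 [c c0 cP]]] := bump_exists R.
(* The strict inequalities define an open set, on which derivatives of a vanishing function vanish
   too. *)
have vanish (f : R -> R) : (forall x, `|x| < 1 / 2 \/ 4 < `|x| -> f x = 0) ->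
    (forall x, `|x| < 1 / 2 \/ 4 < `|x| -> (f^`()%classic : R -> R) x = 0).
  move=> f0 x; apply: (@derive1_eq0_open R f
    [set x | `|x| < 1 / 2 \/ 4 < `|x|]) => //.
  apply: openU.
    apply: (@open_comp _ _ (Num.norm : R -> R) [set y | y < 1 / 2]); last exact: open_lt.
    by move=> ? _; exact: norm_continuous.
  apply: (@open_comp _ _ (Num.norm : R -> R) [set y | 4 < y]); last exact: open_gt.
  by move=> ? _; exact: norm_continuous.
have evU0 (p : {poly R}) (f : R -> R) :
    (forall x, `|x| < 1 / 2 \/ 4 < `|x| -> f x = 0) ->
    forall x, `|x| < 1 / 2 \/ 4 < `|x| -> evU p f x = 0.
  move=> f0 x hx; rewrite /evU /op_poly fct_sumE; apply: big1 => i _.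
  rewrite fctE; suff -> : iter i (@opU R) f x = 0 by rewrite scaler0.
  elim: (i : nat) x hx => [|n IHn] x hx; first exact: f0.
  by rewrite iterS /opU /= /opM /opD (vanish _ IHn)// mulr0.
have [C1 C10 C1P] := Cc_bounded (Cc_evU Q cphi).
have [C2 C20 C2P] := Cc_bounded (Cc_evU P (Cc_opD cphi)).
have Q0 := evU0 Q _ phi0.
have P0 := evU0 P _ (vanish _ phi0).
exists ((C1 + C2) / c) => [|t t1]; first by rewrite divr_ge0 ?addr_ge0// ltW.
have t0 : 0 < t by lra.
have tn0 : t^-1 != 0 by rewrite invr_eq0 gt_eqF.
pose A w := stein_factor P Q (fun x => phi (t^-1 * x)) (X w).
have [iA A0] := steinX (Cc_scale tn0 cphi).
have bound w : t * c * \1_(shell t) w <=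
    A w + (C1 + C2) * (\1_(shell (2^-1 * t)) w + \1_(shell t) w
    + \1_(shell (2 * t)) w).
  rewrite !indic_shell /A stein_factor_scale//.
  set x := X w; have [y xy] : exists y, x = t * y.
    by exists (t^-1 * x); rewrite mulrA divff ?gt_eqF// mul1r.
  have -> : `|x| = t * `|y| by rewrite xy normrM gtr0_norm.
  rewrite xy mulrA mulVf ?gt_eqF// mul1r.
  have e2 : 2 * (2^-1 * t) = t * 1 by rewrite mulrA divff// mul1r mulr1.
  have -> : (2^-1 * t <= t * `|y| <= 2 * (2^-1 * t)) = (2^-1 <= `|y| <= 1).
    by rewrite e2 (mulrC _ t) !ler_pM2l.
  have -> : (t <= t * `|y| <= 2 * t) = (1 <= `|y| <= 2).
    by rewrite -{1}(mulr1 t) (mulrC 2) !ler_pM2l.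
  have -> : (2 * t <= t * `|y| <= 2 * (2 * t)) = (2 <= `|y| <= 4).
    rewrite (mulrC 2 t) mulrCA ler_pM2l// ler_pM2l//.
    by congr (_ && (_ <= _)); rewrite -natrM.
  have [yphi0 yphic] := cP y.
  have [hy|hy] := pselect (`|y| < 1 / 2 \/ 4 < `|y|).
    rewrite phi0// Q0// P0//.
    have -> : (1 <= `|y| <= 2) = false by apply/negbTE/negP => /andP[]; lra.
    rewrite /= !mulr0 !subr0 add0r mulr_ge0 ?addr_ge0//.
  have /andP[y1 y2] : 2^-1 <= `|y| <= 4.
    by apply/andP; split; rewrite leNgt; apply/negP => ?; apply: hy; [left|right]; lra.
  (* The three shells cover the support of the bump; they overlap at endpoints, hence an
     inequality. *)
  have s1 : 1 <= (2^-1 <= `|y| <= 1)%R%:R + (1 <= `|y| <= 2)%R%:R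
      + (2 <= `|y| <= 4)%R%:R :> R.
    rewrite y1 y2 andbT /=; have [a1|a1] := leP `|y| 1.
      by rewrite -addrA lerDl addr_ge0.
    rewrite (ltW a1) /=; have [a2|a2] := leP `|y| 2.
      by rewrite add0r lerDl.
    by rewrite (ltW a2) !add0r.
  have a1 : (C1 + C2) * 1 <= (C1 + C2) * ((2^-1 <= `|y| <= 1)%R%:R
      + (1 <= `|y| <= 2)%R%:R + (2 <= `|y| <= 4)%R%:R).
    by rewrite ler_wpM2l// addr_ge0.
  have a2 : evU Q phi y <= C1 by rewrite (le_trans (ler_norm _)).
  have a3 : t^-1 * evU P (opD phi) y <= C2.
    apply: (@le_trans _ _ (t^-1 * C2)).
      by rewrite ler_wpM2l ?invr_ge0 ?(ltW t0)// (le_trans (ler_norm _)).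
    by rewrite ler_piMl// invf_le1.
  have a4 : t * c * (1 <= `|y| <= 2)%R%:R <= t * (y * phi y).
    rewrite -mulrA ler_wpM2l ?(ltW t0)//.
    by case: (boolP (1 <= `|y| <= 2)) => [/yphic|_]; rewrite ?mulr1 ?mulr0.
  rewrite mulrA in a4; lra.
have {}iA : Pr.-integrable setT (EFin \o A) by [].
have IA0 : (\int[Pr]_w A w)%R = 0.
  by rewrite /Rintegral; move: A0; rewrite unlock => ->.
clearbody A.
pose S w : R :=
  \1_(shell (2^-1 * t)) w + \1_(shell t) w + \1_(shell (2 * t)) w.
have i2 : Pr.-integrable setT
    (EFin \o (fun w => \1_(shell (2^-1 * t)) w + \1_(shell t) w)).
  exact: (@integrableD _ _ _ _ _ measurableT _ _
    (shell_integrable _) (shell_integrable _)).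
have i3 : Pr.-integrable setT (EFin \o S).
  exact: (@integrableD _ _ _ _ _ measurableT _ _ i2 (shell_integrable _)).
have iS : Pr.-integrable setT (EFin \o (fun w => (C1 + C2) * S w)).
  exact: (@integrableZl _ _ _ _ _ measurableT _ _ i3).
have := @le_Rintegral _ _ _ Pr setT _ _ measurableT
  (@integrableZl _ _ _ _ _ measurableT (t * c) _ (shell_integrable t))
  (@integrableD _ _ _ _ _ measurableT _ _ iA iS) (fun w _ => bound w).
rewrite RintegralD// !RintegralZl// IA0 /S !RintegralD// !Rintegral_shell.
rewrite add0r => H.
rewrite -(ler_pM2l (mulr_gt0 t0 c0)); apply: le_trans H _.
rewrite le_eqVlt; apply/orP; left; apply/eqP; field.
by rewrite !gt_eqF.
Qed.

(** Each use of the recurrence gains a factor 1/t. The bound is kept for all t > 0 because t/2 may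
    fall below 1. *)
Lemma shell_decay n : exists C : R, forall t : R, 0 < t -> b t <= C / t ^+ n.
Proof.
have [K K0 KP] := shell_recurrence.
suff [C C0 CP] : exists2 C : R, 0 <= C & forall t : R, 0 < t -> b t <= C / t ^+ n.
  by exists C.
elim: n => [|n [C C0 CP]].
  by exists 1 => // t _; rewrite expr0 divr1.
(* The leading 1 covers t < 1, where b(t) <= 1; the factor 2^n is the cost of evaluating the bound
   at t/2. *)
exists (1 + K * C * (2 ^+ n + 1 + 1)) => [|t t0].
  by rewrite addr_ge0// mulr_ge0// ?mulr_ge0// !addr_ge0// exprn_ge0.
have tn k : 0 < t ^+ k by rewrite exprn_gt0.
rewrite ler_pdivlMr//; have [t1|t1] := ltP t 1.
  apply: (@le_trans _ _ 1).
    by rewrite -[leRHS]mulr1; apply: ler_pM => //;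
      [exact/ltW|apply: exprn_ile1; exact: ltW].
  by rewrite lerDl mulr_ge0// ?mulr_ge0// !addr_ge0// exprn_ge0.
have b1 : b (2^-1 * t) <= C * 2 ^+ n / t ^+ n.
  apply: le_trans (CP _ _) _; first by rewrite mulr_gt0// invr_gt0.
  by rewrite exprMn invfM exprVn invrK mulrA.
have b2 := CP _ t0.
have b3 : b (2 * t) <= C / t ^+ n.
  apply: le_trans (CP _ _) _; first by rewrite mulr_gt0.
  rewrite ler_wpM2l// lef_pV2 ?posrE ?exprn_gt0 ?mulr_gt0//.
  by rewrite lerXn2r ?nnegrE ?ltW// ?mulr_gt0//; lra.
rewrite -ler_pdivlMr//; apply: le_trans (KP _ t1) _.
apply: (@le_trans _ _ (K / t * (C * 2 ^+ n / t ^+ n + C / t ^+ n + C / t ^+ n))).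
  by rewrite ler_wpM2l ?divr_ge0 ?(ltW t0)// !lerD.
apply: (@le_trans _ _ (K * C * (2 ^+ n + 1 + 1) / t ^+ n.+1)).
  rewrite exprS le_eqVlt; apply/orP; left; apply/eqP; field.
  by rewrite !gt_eqF.
by rewrite ler_wpM2r ?invr_ge0 ?ltW// ltrDr.
Qed.

Lemma second_moment : Pr.-integrable setT (EFin \o (fun w => X w ^+ 2)).
Proof.
(* Exponent 3 beats the square: the shell of 2^k contributes at most 4^(k+1) C / 8^k = 4C / 2^k, a
   summable geometric term. *)
have [C CP] := shell_decay 3.
have C0 : 0 <= C.
  by rewrite (le_trans (b_ge0 1))// (le_trans (CP _ ltr01))// expr1n divr1.
pose u k w : \bar R := ((2 ^+ k.+1) ^+ 2 * \1_(shell (2 ^+ k)) w)%:E.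
have u0 k w : (0 <= u k w)%E by rewrite lee_fin mulr_ge0// exprn_ge0// exprn_ge0.
have mu k : measurable_fun setT (u k).
  by apply/measurable_EFinP/measurable_funM => //; exact: measurable_indic.
have pos2 k : 0 < 2 ^+ k :> R by rewrite exprn_gt0.
have intu k : (\int[Pr]_w u k w <= (geometric (4 * C) 2^-1 k)%:E)%E.
  rewrite [leLHS](_ : _ =
      (((2 ^+ k.+1) ^+ 2)%:E * \int[Pr]_w (\1_(shell (2 ^+ k)) w)%:E)%E).
    rewrite integral_indic// setIT -[X in (_ * X)%E]fineK ?fin_num_measure//.
    rewrite -EFinM lee_fin.
    apply: (@le_trans _ _ ((2 ^+ k.+1) ^+ 2 * (C / (2 ^+ k) ^+ 3))).
      by rewrite ler_wpM2l ?sqr_ge0//; exact: CP.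
    rewrite /= exprVn [2 ^+ k.+1]exprS le_eqVlt; apply/orP; left; apply/eqP; field.
    by rewrite gt_eqF.
  under eq_integral do rewrite /u EFinM.
  by rewrite integralZl//; exact: shell_integrable.
have X2u w : ((X w ^+ 2)%:E <= 1 + \sum_(k <oo) u k w)%E.
  have [X1|X1] := ltP `|X w| 1.
    rewrite (@le_trans _ _ 1%E)//; last by rewrite leeDl// nneseries_ge0.
    by rewrite lee_fin -real_normK ?num_real// exprn_ile1// ltW.
  (* The integer part of the binary logarithm of |X|, which selects a dyadic shell containing the
     point. *)
  pose k := trunc_log 2 (Num.truncn `|X w|).
  have tr0 : (0 < Num.truncn `|X w|)%N by rewrite truncn_gt0.
  have lo : 2 ^+ k <= `|X w|.
    rewrite -natrX (@le_trans _ _ (Num.truncn `|X w|)%:R) ?truncn_le//.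
    by rewrite ler_nat trunc_logP.
  have hi : `|X w| <= 2 ^+ k.+1.
    rewrite -natrX; apply: le_trans (ltW (truncnS_gt _)) _.
    by rewrite ler_nat trunc_log_ltn.
  apply: (@le_trans _ _ (u k w)).
    rewrite lee_fin indic_shell lo -exprS hi mulr1 -real_normK ?num_real//.
    by rewrite lerXn2r ?nnegrE// ltW.
  apply: (@le_trans _ _ (\sum_(k <oo) u k w)%E); last by rewrite leeDr.
  apply: le_trans (nneseries_lim_ge k.+1 _); last by move=> n _ _; exact: u0.
  by rewrite big_nat_recr//= leeDr// sume_ge0.
apply/integrableP; split.
  by apply/measurable_EFinP; exact: measurable_funX.
apply: (@le_lt_trans _ _ (\int[Pr]_w (1 + \sum_(k <oo) u k w))%E).
  apply: ge0_le_integral => //.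
  - by apply/measurableT_comp => //; apply/measurable_EFinP; exact: measurable_funX.
  - by apply: emeasurable_funD => //; apply: ge0_emeasurable_sum => //.
  - by move=> w _; rewrite gee0_abs; [exact: X2u|rewrite lee_fin sqr_ge0].
rewrite ge0_integralD//; last 2 first.
  - by move=> w _; exact: nneseries_ge0.
  - by apply: ge0_emeasurable_sum.
rewrite integral_cst//= probability_setT mule1 integral_nneseries//.
apply: lte_add_pinfty; first exact: ltry.
apply: (@le_lt_trans _ _ (4 * C * (1 - 2^-1)^-1)%:E); last exact: ltry.
apply: (@le_trans _ _ (\sum_(k <oo) (geometric (4 * C) 2^-1 k)%:E)%E).
  by apply: lee_nneseries => // n _ _; exact: integral_ge0.
have g0 n : 0 <= geometric (4 * C) 2^-1 n :> R.
  by rewrite geometric_ge0 ?mulr_ge0 ?invr_ge0.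
apply: lime_le; first by apply: is_cvg_nneseries => n _ _; rewrite lee_fin.
apply: nearW => n; rewrite sumEFin lee_fin.
have := @geometric_le_lim R n (4 * C) 2^-1; apply.
- by rewrite mulr_ge0.
- by rewrite invr_gt0.
- by rewrite ger0_norm ?invr_ge0// invf_lt1// ltr1n.
Qed.

End SecondMoment.

(** * Joint laws of independent pairs as product measures *)

Section JointLaw.
Context d (T : measurableType d) (R : realType) (Pr : probability T R).
Implicit Types (X Y U V : {RV Pr >-> R}) (G : R * R -> R).

Let measurable_pair U V : measurable_fun setT (fun w => (U w, V w)).
Proof. exact: measurable_fun_pair. Qed.

Let joint U V : {mfun T >-> (R * R)%type} :=
  HB.pack (fun w => (U w, V w))
    (isMeasurableFun.Build _ _ _ _ _ (measurable_pair U V)).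

Let law X := distribution Pr X.

(** A measure is a product measure once it is so on rectangles. Separating U, V from the marginals
    X, Y lets both (X, Y) and (Y, X) be given the same law. *)
Lemma joint_law X Y U V :
  (forall A B, measurable A -> measurable B ->
    (Pr (U @^-1` A `&` V @^-1` B) = law X A * law Y B)%E) ->
  forall A, measurable A ->
    distribution Pr (joint U V) A = (law X \x law Y)%E A.
Proof.
move=> UV A mA; apply/esym.
by apply: (@product_measure_unique _ _ _ _ _ (law X) (law Y)
  (distribution Pr (joint U V))).
Qed.

Lemma integral_joint X Y U V G :
  (forall A B, measurable A -> measurable B ->
    (Pr (U @^-1` A `&` V @^-1` B) = law X A * law Y B)%E) ->
  measurable_fun setT G ->
  Pr.-integrable setT (EFin \o (fun w => G (U w, V w))) ->
  (law X \x law Y)%E.-integrable setT (EFin \o G) /\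
  (\int[Pr]_w (G (U w, V w))%:E = \int[(law X \x law Y)%E]_z (G z)%:E)%E.
Proof.
move=> UV mG iG; have mG' : measurable_fun setT (EFin \o G) by exact/measurable_EFinP.
have lawE := joint_law UV.
split.
  apply/integrableP; split=> //.
  rewrite (@eq_measure_integral _ _ _ _ (distribution Pr (joint U V)))//.
    rewrite ge0_integral_distribution//; last exact: measurableT_comp.
    by have /integrableP[] := iG.
  by move=> A mA _; exact/esym/lawE.
rewrite (@eq_measure_integral _ _ _ _ (distribution Pr (joint U V)))//.
  by rewrite integral_distribution.
by move=> A mA _; exact/esym/lawE.
Qed.

End JointLaw.

(** * Stein identities for the product of two independent copies *)

Section ProductStein.
Context d (T : measurableType d) (R : realType) (Pr : probability T R).
Variables (X Y : {RV Pr >-> R}) (P Q : {poly R}).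
Hypotheses (densY : has_smooth_density Y) (indXY : independent_RV X Y)
  (idXY : identically_distributed X Y)
  (steinX : stein_operator Pr (stein_factor P Q) (@Cc_infty R) X)
  (steinY : stein_operator Pr (stein_factor P Q) (@Cc_infty R) Y).
Implicit Types (f g : R -> R) (G : R * R -> R).

Lemma distribution_density_set1 a : distribution Pr Y [set a] = 0%E.
Proof.
have [J [p [_ _ _ ->]]] := densY; last exact: measurable_set1.
by apply: (@integral_Sset1 _ _ _ a); exact: subIsetl.
Qed.

Let law_XY A B : measurable A -> measurable B ->
  (Pr (X @^-1` A `&` Y @^-1` B) = distribution Pr X A * distribution Pr Y B)%E.
Proof. exact: indXY. Qed.

Let law_YX A B : measurable A -> measurable B ->
  (Pr (Y @^-1` A `&` X @^-1` B) = distribution Pr X A * distribution Pr Y B)%E.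
Proof.
by move=> mA mB; rewrite (idXY mA) -(idXY mB) setIC indXY// muleC.
Qed.

(** Exchangeability: both ordered pairs follow the product of the two laws. *)
Lemma Rintegral_swap G : measurable_fun setT G ->
  Pr.-integrable setT (EFin \o (fun w => G (X w, Y w))) ->
  Pr.-integrable setT (EFin \o (fun w => G (Y w, X w))) ->
  (\int[Pr]_w G (X w, Y w) = \int[Pr]_w G (Y w, X w))%R.
Proof.
move=> mG iXY iYX; rewrite /Rintegral.
have [_ ->] := integral_joint law_XY mG iXY.
by have [_ ->] := integral_joint law_YX mG iYX.
Qed.

(* The fibre over y = 0 is excluded because x |-> f (0 * x) is not compactly
   supported; it is negligible since Y has a density. *)
Lemma stein_fibrewise G : measurable_fun setT G ->
  Pr.-integrable setT (EFin \o (fun w => G (X w, Y w))) ->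
  (forall y, y != 0 -> exists c f, Cc_infty f /\
     forall x, G (x, y) = c * stein_factor P Q f x) ->
  (\int[Pr]_w G (X w, Y w) = 0)%R.
Proof.
move=> mG iG fibre; rewrite /Rintegral.
have [iG' ->] := integral_joint law_XY mG iG.
rewrite -integral21_prod_meas1// /fubini_G.
pose H (y : R) : \bar R := (\int[distribution Pr X]_x (G (x, y))%:E)%E.
have H0 y : y != 0 -> H y = 0%E.
  move=> y0; have [c [f [cf Gf]]] := fibre _ y0.
  have [iA A0] := steinX cf; rewrite unlock in A0.
  rewrite /H integral_distribution//; last 2 first.
  - apply/measurable_EFinP; exact: measurableT_comp.
  - rewrite (_ : _ \o _ = (fun w => c%:E * (stein_factor P Q f (X w))%:E)%E).
      exact: integrableZl.
    by apply/funext => w /=; rewrite Gf.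
  under eq_integral do rewrite /= Gf EFinM.
  by rewrite integralZl//= A0 mule0.
(* The fibre integral vanishes off y = 0; its value [H 0] is weighted by the null mass of the
   origin. *)
rewrite (_ : (\int[_]_y _)%E =
    (\int[distribution Pr Y]_y (cst (H 0%R) \_ [set 0%R]) y)%E).
  rewrite -integral_mkcond integral_cst; last exact: measurable_set1.
  by rewrite [X in (_ * X)%E]distribution_density_set1 mule0.
apply: eq_integral => y _; rewrite patchE; case: ifPn => [|].
  by rewrite inE => /= ->.
by rewrite notin_setE => /= /eqP; exact: H0.
Qed.

(** The factor [Y] comes first so that f(Z), at fixed y, is the dilate x |-> f(yx) in the form used
    above. *)
Let Z w := Y w * X w.

Let mZ : measurable_fun setT Z. Proof. exact: measurable_funM. Qed.

(** One domination for all the weights 1, X, Y, X^2 and Y^2; the finite second moments enter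
    here. *)
Let dominated (V : T -> R) f : measurable_fun setT V -> Cc_infty f ->
  (forall w, `|V w| <= 1 + (X w ^+ 2 + Y w ^+ 2)) ->
  Pr.-integrable setT (EFin \o (fun w => V w * f (Z w))).
Proof.
move=> mV cf VW; have [C C0 fC] := Cc_bounded cf.
apply: (@le_integrable _ _ _ _ _ measurableT _
  (EFin \o (fun w => C * (1 + (X w ^+ 2 + Y w ^+ 2))))).
- apply/measurable_EFinP; apply: measurable_funM => //.
  by apply: measurableT_comp => //; exact: Cc_measurable.
- move=> w _; rewrite lee_fin normrM mulrC [leRHS]ger0_norm; last first.
    by rewrite mulr_ge0// !addr_ge0 ?sqr_ge0.
  by apply: ler_pM.
have i2 := @integrableD _ _ _ _ _ measurableT _ _
  (second_moment steinX) (second_moment steinY).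
have i1 := @finite_measure_integrable_cst _ _ _ Pr _ 1 measurableT.
exact: (@integrableZl _ _ _ _ _ measurableT C _
  (@integrableD _ _ _ _ _ measurableT _ _ i1 i2)).
Qed.

Let e f := (\int[Pr]_w f (Z w))%R.
Let h f := (\int[Pr]_w (Y w * f (Z w)))%R.
(** An auxiliary functional, eliminated when [stein3] is substituted into [stein2]. *)
Let s f := (\int[Pr]_w (Y w ^+ 2 * f (Z w)))%R.

Let ie f : Cc_infty f -> Pr.-integrable setT (EFin \o (fun w => f (Z w))).
Proof.
move=> cf; under eq_fun do rewrite -[f _]mul1r.
apply: (@dominated (cst 1)) => // w.
by rewrite normr1 lerDl addr_ge0 ?sqr_ge0.
Qed.

Let ihY f : Cc_infty f ->
  Pr.-integrable setT (EFin \o (fun w => Y w * f (Z w))).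
Proof.
move=> cf; apply: dominated => // w.
(* Expanding (|Y| - 1)^2 >= 0 gives 2|Y| <= 1 + Y^2. *)
have := sqr_ge0 (X w); have := sqr_ge0 (`|Y w| - 1).
rewrite sqrrB1 real_normK ?num_real//.
have := normr_ge0 (Y w); lra.
Qed.

Let ihX f : Cc_infty f ->
  Pr.-integrable setT (EFin \o (fun w => X w * f (Z w))).
Proof.
move=> cf; apply: dominated => // w.
have := sqr_ge0 (Y w); have := sqr_ge0 (`|X w| - 1).
rewrite sqrrB1 real_normK ?num_real//.
have := normr_ge0 (X w); lra.
Qed.

Let isY f : Cc_infty f ->
  Pr.-integrable setT (EFin \o (fun w => Y w ^+ 2 * f (Z w))).
Proof.
move=> cf; apply: dominated => // [|w]; first exact: measurable_funX.
rewrite ger0_norm ?sqr_ge0//; have := sqr_ge0 (X w); lra.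
Qed.

Let isX f : Cc_infty f ->
  Pr.-integrable setT (EFin \o (fun w => X w ^+ 2 * f (Z w))).
Proof.
move=> cf; apply: dominated => // [|w]; first exact: measurable_funX.
rewrite ger0_norm ?sqr_ge0//; have := sqr_ge0 (Y w); lra.
Qed.

Let measurable_yx f : Cc_infty f ->
  measurable_fun setT (fun z : R * R => f (z.2 * z.1)).
Proof.
move=> cf; apply: (@measurableT_comp _ _ _ _ _ _ f); first exact: Cc_measurable.
by apply: measurable_funM; [exact: measurable_snd|exact: measurable_fst].
Qed.

Let hX f : Cc_infty f -> (\int[Pr]_w (X w * f (Z w)))%R = h f.
Proof.
move=> cf; pose G (z : R * R) := z.1 * f (z.2 * z.1).
have eG w : Y w * f (Z w) = G (Y w, X w).
  by rewrite /G /Z /= [Y w * X w]mulrC.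
rewrite /h; under [in RHS]eq_Rintegral do rewrite eG.
apply: (@Rintegral_swap G).
- by apply: measurable_funM; [exact: measurable_fst|exact: measurable_yx].
- exact: ihX.
- by have := ihY cf; under eq_fun do rewrite eG.
Qed.

Let sX f : Cc_infty f -> (\int[Pr]_w (X w ^+ 2 * f (Z w)))%R = s f.
Proof.
move=> cf; pose G (z : R * R) := z.1 ^+ 2 * f (z.2 * z.1).
have eG w : Y w ^+ 2 * f (Z w) = G (Y w, X w).
  by rewrite /G /Z /= [Y w * X w]mulrC.
rewrite /s; under [in RHS]eq_Rintegral do rewrite eG.
apply: (@Rintegral_swap G).
- apply: measurable_funM; last exact: measurable_yx.
  by apply: measurable_funX; exact: measurable_fst.
- exact: isX.
- by have := isY cf; under eq_fun do rewrite eG.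
Qed.

Let Rintegral_sub3 (A B C : T -> R) :
  Pr.-integrable setT (EFin \o A) -> Pr.-integrable setT (EFin \o B) ->
  Pr.-integrable setT (EFin \o C) ->
  Pr.-integrable setT (EFin \o (fun w => A w - B w - C w)) /\
  (\int[Pr]_w (A w - B w - C w) =
   \int[Pr]_w A w - \int[Pr]_w B w - \int[Pr]_w C w)%R.
Proof.
move=> iA iB iC.
have iAB : Pr.-integrable setT (EFin \o (fun w => A w - B w)).
  exact: (@integrableB _ _ _ _ _ measurableT _ _ iA iB).
split; first exact: (@integrableB _ _ _ _ _ measurableT _ _ iAB iC).
by rewrite RintegralB// RintegralB.
Qed.

Let measurable_sub3 (A B C : R * R -> R) :
  measurable_fun setT A -> measurable_fun setT B -> measurable_fun setT C ->
  measurable_fun setT (fun z => A z - B z - C z).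
Proof. by move=> mA mB mC; do 2 apply: measurable_funB => //. Qed.

Let stein1 f : Cc_infty f -> h f = e (evU Q f) + h (evU P (opD f)).
Proof.
move=> cf; have cQ := Cc_evU Q cf; have cP := Cc_evU P (Cc_opD cf).
have [iG IG] := Rintegral_sub3 (ihX cf) (ie cQ) (ihY cP).
have G0 := @stein_fibrewise (fun z => z.1 * f (z.2 * z.1)
  - evU Q f (z.2 * z.1) - z.2 * evU P (opD f) (z.2 * z.1)) _ iG _.
move: IG; rewrite G0 ?hX//.
- rewrite -/(e _) -/(h _); lra.
- apply: measurable_sub3; try exact: measurable_yx.
    by apply: measurable_funM; [exact: measurable_fst|exact: measurable_yx].
  by apply: measurable_funM; [exact: measurable_snd|exact: measurable_yx].
- move=> y y0; exists 1, (fun x => f (y * x)); split; first exact: Cc_scale.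
  by move=> x; rewrite mul1r stein_factor_scale.
Qed.

Let stein2 f : Cc_infty f ->
  e (opM f) = h (evU Q f) + s (evU P (opD f)).
Proof.
move=> cf; have cQ := Cc_evU Q cf; have cP := Cc_evU P (Cc_opD cf).
have [iG IG] := Rintegral_sub3 (ie (Cc_opM cf)) (ihY cQ) (isY cP).
have G0 := @stein_fibrewise (fun z => opM f (z.2 * z.1)
  - z.2 * evU Q f (z.2 * z.1) - z.2 ^+ 2 * evU P (opD f) (z.2 * z.1)) _ iG _.
move: IG; rewrite G0.
- rewrite -/(e _) -/(h _) -/(s _); lra.
- apply: measurable_sub3.
  + exact: (measurable_yx (Cc_opM cf)).
  + by apply: measurable_funM; [exact: measurable_snd|exact: measurable_yx].
  + apply: measurable_funM; last exact: measurable_yx.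
    by apply: measurable_funX; exact: measurable_snd.
(* On a fibre the weight [y] is a constant, so it serves as the multiplier [c]. *)
- move=> y y0; exists y, (fun x => f (y * x)); split; first exact: Cc_scale.
  move=> x; rewrite stein_factor_scale// /opM /=; ring.
Qed.

(** The test function is x f(yx): its derivative is ((U + I) f)(yx), and the prefactor x turns Q(U)
    into Q(U + I). The weights X and X^2 are then exchanged for Y and Y^2. *)
Let stein3 f : Cc_infty f ->
  s f = h (evU (shiftp 1 Q) f) + e (evU P (evU ('X + 1) f)).
Proof.
move=> cf; have cQ := Cc_evU (shiftp 1 Q) cf.
have cP := Cc_evU P (Cc_evU ('X + 1) cf).
have [iG IG] := Rintegral_sub3 (isX cf) (ihX cQ) (ie cP).
have G0 := @stein_fibrewise (fun z => z.1 ^+ 2 * f (z.2 * z.1)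
  - z.1 * evU (shiftp 1 Q) f (z.2 * z.1) - evU P (evU ('X + 1) f) (z.2 * z.1))
  _ iG _.
move: IG; rewrite G0 ?hX ?sX//.
- rewrite -/(e _); lra.
- apply: measurable_sub3.
  + apply: measurable_funM; last exact: measurable_yx.
    by apply: measurable_funX; exact: measurable_fst.
  + by apply: measurable_funM; [exact: measurable_fst|exact: measurable_yx].
  + exact: measurable_yx.
- move=> y y0; exists 1, (opM (fun x => f (y * x))); split.
    exact/Cc_opM/Cc_scale.
  move=> x; rewrite mul1r.
  have -> : stein_factor P Q (opM (fun x => f (y * x))) x =
    x * (x * f (y * x)) - evU Q (opM (fun x => f (y * x))) x
    - evU P (opD (opM (fun x => f (y * x)))) x by [].
  rewrite evU_opM_scale// opD_opM; last exact: Cc_scale.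
  rewrite opU_scale//.
  have -> : (fun x => opU f (y * x)) + (fun x => f (y * x)) =
      (fun x => evU ('X + 1) f (y * x)).
    have -> : evU ('X + 1) f = opU f + f by rewrite evU_shift scale1r.
    by [].
  by rewrite evU_scale ?mulrA ?expr2//; exact: Cc_evU.
Qed.

Lemma stein_operator_product :
  stein_operator Pr (stein_product P Q) (@Cc_infty R) (X \* Y).
Proof.
move=> f cf; have cS : Cc_infty (stein_product P Q f).
  rewrite stein_productE//; solve_Cc.
have ZE w : (X \* Y) w = Z w by exact: mulrC.
have iS : Pr.-integrable setT (EFin \o (stein_product P Q f \o (X \* Y))).
  by have := ie cS; under eq_fun do rewrite -ZE.
split=> //; rewrite unlock.
rewrite -[LHS]fineK ?integrable_fin_num//; congr EFin.
have -> : fine (\int[Pr]_w ((stein_product P Q f \o (X \* Y)) w)%:E)%E =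
    e (stein_product P Q f).
  by apply: eq_Rintegral => w _; rewrite /= -ZE.
apply: (@stein_product_eq0 _ P Q e h).
- by move=> f1 f2 c1 c2; rewrite /e RintegralD//; exact: ie.
- move=> f1 f2 c1 c2; rewrite /h -RintegralD//; try exact: ihY.
  by apply: eq_Rintegral => w _; rewrite -mulrDr.
- exact: stein1.
(* [stein3] is taken at P(U) g', the argument of [s] in [stein2]. *)
- move=> g cg; rewrite stein2// stein3 ?addrA//; exact/Cc_evU/Cc_opD.
- exact: cf.
Qed.

End ProductStein.

Theorem proposition2p1 (d : measure_display) (T : measurableType d)
    (R : realType) (Pr : probability T R) (X Y : {RV Pr >-> R})
    (P Q : {poly R}) (F : set (R -> R)) :
  has_smooth_density X -> has_smooth_density Y ->
  independent_RV X Y -> identically_distributed X Y ->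
  @Cc_infty R `<=` F ->
  stein_operator Pr (stein_factor P Q) F X ->
  stein_operator Pr (stein_factor P Q) F Y ->
  stein_operator Pr (stein_product P Q) (@Cc_infty R) (X \* Y).
Proof.
move=> _ densY indXY idXY CcF steinX steinY.
have weaken V : stein_operator Pr (stein_factor P Q) F V ->
    stein_operator Pr (stein_factor P Q) (@Cc_infty R) V.
  by move=> steinV f /CcF; exact: steinV.
exact: (stein_operator_product densY indXY idXY (weaken _ steinX)
  (weaken _ steinY)).
Qed.
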